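(* For every $\epsilon>0$ there is a constant $C_\epsilon>0$ depending only on $\epsilon$ such that the following holds. Let $Q\ge 1$, $M$, $N$ be integers with $N>0$, let $\alpha,\beta,\gamma\in\mathbb{R}$ with $\alpha>0$, put $f(x)=\alpha x^2+\beta x+\gamma$, and suppose that $\beta/\alpha=a/b\in\mathbb{Q}$ with $a,b\in\mathbb{Z}$, $b>0$ and $\gcd(a,b)=1$. Let $$F(Q)=\{p/q\in\mathbb{Q} : 1\le q\le Q,\ 0\le p<q,\ \gcd(p,q)=1\}.$$ Then for every sequence of complex numbers $(a_n)_{M+1\le n\le M+N}$, $$\sum_{x\in F(Q)}\left|\sum_{n=M+1}^{M+N} a_n\, e\left(x f(n)\right)\right|^2 \le C_\epsilon \left(Q^2+Q\sqrt{\alpha N\left(|M|+N+|a|/b\right)+1}\right)\Pi\, Z,$$ where $$\Pi=\left(\frac{b}{\alpha}+1\right)^{\frac12+\epsilon}\left[Nb(|M|+N)+|a|+\frac{b}{\alpha}\right]^{\epsilon}\quad\text{and}\quad Z=\sum_{n=M+1}^{M+N}|a_n|^2 .$$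
   Context: Notation: $e(t)=\exp(2\pi i t)$ for real $t$. *)

(* Defs.v *)
From HB Require Import structures.
From mathcomp Require Import all_boot all_order all_algebra.
From mathcomp Require Import complex.
From mathcomp Require Import all_classical all_reals all_analysis.

Set Implicit Arguments.
Unset Strict Implicit.
Unset Printing Implicit Defensive.

Import Order.TTheory GRing.Theory Num.Theory.
Local Open Scope classical_set_scope.
Local Open Scope ring_scope.

(* The complex exponential is not available on R[i]; this is exp(2 pi i t)
   through Euler's formula. *)
Definition e2pi (R : realType) (t : R) : R[i] :=
  Complex (cos (2 * pi * t)) (sin (2 * pi * t)).

(* 0/1 is included, and a rational is listed once, being a set element. *)
Definition farey (Q : nat) : set rat :=
  [set x | exists p q : nat,
     [/\ (1 <= q <= Q)%N, (p < q)%N, coprime p q & x = p%:R / q%:R]].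

(* [\sum_(x \in A) F x] would default to 0 on an infinite support; this rules
   it out for [A = farey Q]. *)
Lemma finite_farey (Q : nat) : finite_set (farey Q).
Proof.
pose s : seq rat :=
  allpairs (fun q p : nat => p%:R / q%:R) (iota 0 Q.+1) (iota 0 Q.+1).
apply: (@sub_finite_set _ _ [set` s]); last exact: finite_seq.
move=> x [p [q [/andP[_ qQ] pq _ ->]]].
change (is_true ((p%:R / q%:R : rat) \in s)).
apply/allpairsP; exists (q, p).
by split=> //; rewrite mem_iota add0n ltnS ?qQ ?(leq_trans (ltnW pq) qQ).
Qed.

Definition quadf (R : realType) (alpha beta gamma x : R) : R :=
  alpha * x ^+ 2 + beta * x + gamma.

Definition PiFactor (R : realType) (eps alpha : R) (M : int) (N : nat)
    (a b : int) : R :=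
  (b%:~R / alpha + 1) `^ (1 / 2 + eps) *
  (N%:R * b%:~R * (`|M%:~R| + N%:R) + `|a%:~R| + b%:~R / alpha) `^ eps.

(* [normc] is the R-valued modulus; the sequence is read at the integers
   M + k with 1 <= k <= N. *)
Definition ZFactor (R : realType) (M : int) (N : nat) (u : int -> R[i]) : R :=
  \sum_(1 <= k < N.+1) Normc.normc (u (M + k%:Z)) ^+ 2.

(* Main.v *)
Require Import Defs.
From HB Require Import structures.
From mathcomp Require Import all_boot all_order all_algebra.
From mathcomp Require Import complex.
From mathcomp Require Import all_classical all_reals all_analysis.
From mathcomp Require Import ring lra zify.

Set Implicit Arguments.
Unset Strict Implicit.
Unset Printing Implicit Defensive.

Import Order.TTheory GRing.Theory Num.Theory.
Local Open Scope classical_set_scope.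
Local Open Scope ring_scope.

(** Write [K(n, m) = (n - m)(b(n + m) + a)].  Since
    [beta / alpha = a / b], [f n - f m = kappa K(n, m)] with
    [kappa = alpha / b], so expanding the squares bounds the left-hand side by
    the sum over pairs of [|u_n| |u_m| |T(K(n, m))|], where
    [T(k) = \sum_x e(x kappa k)] runs over the Farey fractions
    ([square_sum_le]).

    The pairs with [K(n, m) = 0] are few: each [n] has at most two partners
    [m], and [|T(0)| <= Q^2], which gives a contribution [2 Q^2 Z].

    For the other pairs, Cauchy-Schwarz over the pairs themselves gives at most
    [Z W^(1/2)], where [W] sums [|T(K(n, m))|^2] over the pairs with
    [K(n, m) <> 0].  An integer [k <> 0] is represented at most twice as often
    as it has divisors ([count_representations]), so up to a factor
    [O(K0^eps)] ([divisor_bound]), [W] is at most the sum of [|T(k)|^2] over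
    [|k| <= K0], where [K0] bounds all the [|K(n, m)|].

    That mean square is the large sieve for the points [kappa x].  Every
    [|k| <= K0] is a difference [j - i] with [0 <= i, j <= 2 K0] in at least
    [K0 + 1] ways ([count_differences]), and summing [|T(j - i)|^2] over all
    such [i, j] yields [\sum_(x, y) |D_L(kappa (x - y))|^2] with the Dirichlet
    kernel [D_L], [L = 2 K0 + 1] ([exchange_squares]).  The kernel is
    concentrated near the integers; for fixed [x] the points [kappa (x - y)]
    are [kappa / Q^2]-spaced in an interval that meets [O(kappa + 1)] unit
    cells, and each cell contributes [O(L^2 + L Q^2 / kappa)]
    ([dirichlet_spaced_sum]).  Altogether
    [W << K0^eps Q^2 (1 + b / alpha) (Q^2 + kappa K0)], and
    [kappa K0 << alpha N (|M| + N + |a| / b)]. *)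

(** * The divisor bound *)

(** The list of divisors is built from the factorisation: a prime power
    [p ^ e] merges [e] further copies, scaled by powers of [p], into the list
    obtained so far. *)
Lemma size_divisors (n : nat) :
  size (divisors n) = (\prod_(f <- prime_decomp n) f.2.+1)%N.
Proof.
rewrite /divisors; elim: (prime_decomp n) => [|[p e] s IHs] /=.
  by rewrite big_nil.
rewrite big_cons -IHs /=.
set ds := foldr _ _ _.
elim: {IHs} e => [|e IHe] /=; first by rewrite mul1n.
by rewrite size_merge size_cat size_map IHe mulSn addnC.
Qed.

Lemma powRXn (R : realType) (x eps : R) (n : nat) :
  0 <= x -> (x ^+ n) `^ eps = (x `^ eps) ^+ n.
Proof.
move=> x0; rewrite -powR_mulrn // -powRrM mulrC powRrM powR_mulrn //.
exact: powR_ge0.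
Qed.

Lemma powR_prod (R : realType) (T : Type) (s : seq T) (F : T -> R) (eps : R) :
  (forall i, 0 <= F i) ->
  (\prod_(i <- s) F i) `^ eps = \prod_(i <- s) F i `^ eps.
Proof.
move=> F0; elim: s => [|i s IHs]; first by rewrite !big_nil powR1.
by rewrite !big_cons powRM ?IHs ?prodr_ge0.
Qed.

(** Small primes lose only a bounded factor: Bernoulli's inequality makes the
    geometric growth [(1 + h) ^ e] dominate [e + 1] uniformly in [e]. *)
Lemma succn_le_expr_bernoulli (R : realType) (h : R) (e : nat) :
  0 < h -> e.+1%:R <= (1 + h^-1) * (1 + h) ^+ e.
Proof.
move=> h0.
have hV : h^-1 * h = 1 by rewrite mulVf // gt_eqF.
have hV0 : 0 < h^-1 by rewrite invr_gt0.
have B : 1 + e%:R * h <= (1 + h) ^+ e.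
  elim: e => [|e IHe]; first by rewrite mul0r addr0 expr0.
  rewrite exprS; apply: le_trans (ler_wpM2l _ IHe); last by lra.
  rewrite -natr1; have : 0 <= e%:R :> R by []. nra.
apply: le_trans (ler_wpM2l _ B); last by lra.
have e0 : 0 <= e%:R :> R by [].
rewrite -natr1.
have -> : (1 + h^-1) * (1 + e%:R * h) = 1 + e%:R * h + h^-1 + e%:R * (h^-1 * h).
  by ring.
rewrite hV; nra.
Qed.

(** Both sides factor over the primes dividing [n].  As soon as
    [p ^ eps >= 2], the factor [e + 1 <= 2 ^ e] is at most [(p ^ e) ^ eps]; only
    the finitely many smaller primes cost a constant, which [eps] determines. *)
Lemma divisor_bound (R : realType) (eps : R) : 0 < eps ->
  exists2 C : R, 0 < C &
    forall n : nat, (0 < n)%N -> (size (divisors n))%:R <= C * n%:R `^ eps.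
Proof.
move=> eps0.
pose h : R := 2 `^ eps - 1.
have h0 : 0 < h.
  have: 1 `^ eps < 2 `^ eps :> R by rewrite gt0_ltr_powR // ?nnegrE; lra.
  by rewrite powR1 /h; lra.
pose A : R := 1 + h^-1.
have A1 : 1 <= A by rewrite lerDl invr_ge0 ltW.
pose P0 := (Num.truncn (2 `^ eps^-1 : R)).+1.
pose c (p : nat) : R := if (p < P0)%N then A else 1.
exists (A ^+ P0); first by rewrite exprn_gt0 //; lra.
move=> n n0.
have factor (f : nat * nat) : f \in prime_decomp n ->
    f.2.+1%:R <= c f.1 * (f.1 ^ f.2)%:R `^ eps.
  case: f => p e /mem_prime_decomp[/prime_gt1 p2 _ _] /=.
  rewrite natrX powRXn // /c; case: ltnP => pP.
    apply: le_trans (succn_le_expr_bernoulli e h0) _.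
    rewrite ler_wpM2l //; first by rewrite -/A; lra.
    rewrite lerXn2r ?nnegrE ?powR_ge0 //; first by lra.
    have -> : 1 + h = 2 `^ eps by rewrite /h; ring.
    by rewrite ge0_ler_powR ?nnegrE // ?(ltW eps0) // ler_nat.
  rewrite mul1r.
  have p2e : 2 <= p%:R `^ eps :> R.
    have <- : (2 `^ eps^-1) `^ eps = 2 :> R.
      by rewrite -powRrM mulVf ?gt_eqF // powRr1.
    rewrite ge0_ler_powR ?nnegrE ?powR_ge0 // ?(ltW eps0) //.
    apply: le_trans (ltW (truncnS_gt _)) _; rewrite ler_nat //.
  apply: le_trans (_ : 2 ^+ e <= _); first by rewrite -natrX ler_nat ltn_expl.
  by rewrite lerXn2r ?nnegrE ?powR_ge0.
rewrite size_divisors natr_prod.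
apply: (@le_trans _ _
  (\prod_(f <- prime_decomp n) (c f.1 * (f.1 ^ f.2)%:R `^ eps))).
  rewrite big_seq [leRHS]big_seq; apply: ler_prod => f fn.
  by rewrite ler0n factor.
rewrite big_split /= {3}(prod_prime_decomp n0) natr_prod powR_prod //.
apply: ler_wpM2r; first by apply: prodr_ge0 => i _; exact: powR_ge0.
have -> : \prod_(f <- prime_decomp n) c f.1 = \prod_(p <- primes n) c p.
  by rewrite big_map.
rewrite /c -big_mkcond /= big_const_seq iter_mulr_1 -size_filter.
rewrite ler_weXn2l //; set s := seq.filter _ _.
have <- : size (iota 0 P0) = P0 by rewrite size_iota.
apply: uniq_leq_size; first by rewrite filter_uniq ?primes_uniq.
by move=> p; rewrite mem_filter mem_iota => /andP[].
Qed.

(** * Exponentials and the Dirichlet kernel *)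

Section SineLowerBound.
Import numFieldNormedType.Exports.

(** A weak form of Jordan's inequality.  By the mean value theorem the slope of
    [sin] between [0] and [y / 2] is at least [cos (y / 2)], so doubling the
    angle gives [sin y >= y cos(y / 2) ^ 2], and
    [2 cos(y / 2) ^ 2 = 1 + cos y >= 1]. *)
Lemma half_le_sin (R : realType) (y : R) :
  0 <= y <= pi / 2 -> y / 2 <= sin y.
Proof.
move=> /andP[y0 yp]; pose z := y / 2.
have yz : y = z *+ 2 by rewrite /z; field.
have pi0 := @pi_gt0 R.
have [c c_itv sz] : exists2 c, c \in `[0, z]%R &
    sin z - sin 0 = cos c * (z - 0).
  apply: (@MVT_segment _ sin cos 0 z).
  - by rewrite /z; lra.
  - exact/continuous_subspaceT/continuous_sin.
move: c_itv; rewrite in_itv /= => /andP[c0 cz]; rewrite sin0 !subr0 in sz.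
have cosz : cos z <= cos c.
  case: (ltgtP c z) cz => [cz _|//|-> //]; apply: ltW.
  by rewrite ltr_cos // in_itv /=; apply/andP;
     split; rewrite /z; move: cz; rewrite /z; lra.
have cosy : 0 <= cos y by apply: cos_ge0_pihalf; lra.
have cosz0 : 0 <= cos z by apply: cos_ge0_pihalf; rewrite /z; lra.
have cos2 : 1 <= 2 * cos z ^+ 2.
  by move: cosy; rewrite yz cos_mulr2n; lra.
rewrite {2}yz sin_mulr2n sz.
have z0 : 0 <= z by rewrite /z; lra.
have : cos z * cos z * z <= cos z * cos c * z by rewrite ler_wpM2r ?ler_wpM2l.
nra.
Qed.

End SineLowerBound.

Section Cis.
Variable R : realType.
Implicit Types (s t : R) (x y z : R[i]).
Import Normc.

Lemma e2piD s t : e2pi (s + t) = e2pi s * e2pi t.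
Proof.
rewrite /e2pi mulrDr cosD sinD; simpc.
by congr Complex; rewrite addrC [_ * cos _]mulrC.
Qed.

Lemma e2pi0 : e2pi (0 : R) = 1.
Proof. by rewrite /e2pi mulr0 cos0 sin0. Qed.

Lemma e2piN t : e2pi (- t) = ((e2pi t)^*)%C.
Proof. by rewrite /e2pi mulrN cosN sinN. Qed.

Lemma normc_e2pi t : normc (e2pi t) = 1.
Proof. by rewrite /= cos2Dsin2 sqrtr1. Qed.

Lemma e2piMn (n : nat) t : e2pi (n%:R * t) = e2pi t ^+ n.
Proof.
elim: n => [|n IHn]; first by rewrite mul0r e2pi0 expr0.
by rewrite -natr1 mulrDl mul1r e2piD IHn exprSr.
Qed.

Lemma e2pi_int (m : int) : e2pi (m%:~R : R) = 1.
Proof.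
have e1 : e2pi (1 : R) = 1 by rewrite /e2pi mulr1 mulr_natl cos2pi sin2pi.
have en (n : nat) : e2pi (n%:R : R) = 1.
  by rewrite -[n%:R]mulr1 e2piMn e1 expr1n.
case: m => n; first exact: en.
by rewrite NegzE rmorphN /= e2piN en conjc1.
Qed.

Lemma e2piB_int t (m : int) : e2pi (t - m%:~R) = e2pi t.
Proof. by rewrite e2piD -rmorphN /= e2pi_int mulr1. Qed.

Lemma normc_ge0 z : 0 <= normc z.
Proof. by case: z => a b; exact: sqrtr_ge0. Qed.

Lemma sqr_normc z : (normc z ^+ 2)%:C%C = z * (z^*)%C.
Proof.
case: z => a b; rewrite /normc sqr_sqrtr ?addr_ge0 ?sqr_ge0 //.
by simpc; congr Complex; rewrite ?expr2 // [b * a]mulrC addrC subrr.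
Qed.

Lemma normc_real (r : R) : normc (r%:C)%C = `|r|.
Proof. by rewrite /= expr0n addr0 sqrtr_sqr. Qed.

Lemma normc_sum (I : Type) (s : seq I) (P : pred I) (F : I -> R[i]) :
  normc (\sum_(i <- s | P i) F i) <= \sum_(i <- s | P i) normc (F i).
Proof.
elim/big_rec2: _ => [|i y z _ IH]; first by rewrite normc0.
exact: le_trans (le_normcD _ _) (lerD _ IH).
Qed.

(** [|e(s) - 1| = 2 |sin (pi s)|], and [pi >= 2] absorbs the loss in
    [half_le_sin]. *)
Lemma normc_e2pi_sub1_ge s : `|s| <= 1 / 2 ->
  4 * s ^+ 2 <= normc (e2pi s - 1) ^+ 2.
Proof.
move=> s12.
have -> : normc (e2pi s - 1) ^+ 2 = 4 * sin (pi * `|s|) ^+ 2.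
  rewrite /e2pi; simpc; rewrite /normc sqr_sqrtr ?addr_ge0 ?sqr_ge0 //.
  have -> : sin (pi * `|s|) ^+ 2 = sin (pi * s) ^+ 2 :> R.
    by case: (ger0P s) => _ //; rewrite mulrN sinN sqrrN.
  have -> : 2 * pi * s = (pi * s) *+ 2 by rewrite -[RHS]mulr_natl mulrA.
  rewrite cos_mulr2n sin_mulr2n.
  have := cos2Dsin2 (pi * s); set c := cos _; set d := sin _ => cd.
  have -> : c ^+ 2 = 1 - d ^+ 2 by lra.
  have -> : ((1 - d ^+ 2) *+ 2 - 1 - 1) ^+ 2 + (c * d *+ 2) ^+ 2
    = 4 * d ^+ 2 * (d ^+ 2 + c ^+ 2) by ring.
  by rewrite [d ^+ 2 + _]addrC cd mulr1.
have pi2 := @pi_ge2 R.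
have s0 : 0 <= `|s| by [].
have sl : `|s| <= sin (pi * `|s|).
  apply: le_trans (half_le_sin _); first by nra.
  by apply/andP; split; nra.
by rewrite -(real_normK (num_real s)); nra.
Qed.

Definition dirichlet (L : nat) t : R[i] := \sum_(0 <= j < L) e2pi (j%:R * t).

Lemma dirichlet_mul_sub1 L t :
  (e2pi t - 1) * dirichlet L t = e2pi (L%:R * t) - 1.
Proof.
rewrite /dirichlet e2piMn subrX1 big_mkord; congr (_ * _).
by apply: eq_bigr => i _; rewrite e2piMn.
Qed.

(** One formula for the two classical bounds [|D_L| <= L] and
    [|D_L(t)| <= 1 / |t - m|], the latter from summing the geometric
    progression.  Unlike their minimum, this majorant can be summed over spaced
    points by telescoping. *)
Lemma dirichlet_le L t (m : int) : `|t - m%:~R| <= 1 / 2 ->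
  normc (dirichlet L t) ^+ 2
    <= 4 * L%:R ^+ 2 / (1 + L%:R * `|t - m%:~R|) ^+ 2.
Proof.
move=> tm; set s := `|_| in tm *; set X := normc _.
have s0 : 0 <= s := normr_ge0 _.
have X0 : 0 <= X := normc_ge0 _.
have L0 : 0 <= L%:R :> R by [].
have XL : X <= L%:R.
  apply: le_trans (normc_sum _ _ _) _.
  under eq_bigr do rewrite normc_e2pi.
  by rewrite sumr_const_nat subn0.
have Xs : X * s <= 1.
  have e1 : normc (e2pi (t - m%:~R) - 1) * X <= 2.
    rewrite e2piB_int -normcM dirichlet_mul_sub1.
    apply: le_trans (le_normcD _ _) _.
    by rewrite normc_e2pi normcN normc1.
  have := normc_e2pi_sub1_ge tm; have := normc_ge0 (e2pi (t - m%:~R) - 1).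
  move: e1; set Y := normc _ => e1 Y0.
  rewrite -[(t - _) ^+ 2](real_normK (num_real _)) -/s => Ys.
  have : (2 * s) ^+ 2 <= Y ^+ 2 by apply: le_trans Ys; lra.
  by rewrite ler_pXn2r ?nnegrE ?mulr_ge0 // => Ys'; nra.
have Ls0 : 0 <= L%:R * s by rewrite mulr_ge0.
rewrite ler_pdivlMr; last by rewrite exprn_gt0 //; lra.
rewrite -exprMn -[4](_ : 2 ^+ 2 = _); last by ring.
rewrite -exprMn lerXn2r ?nnegrE ?mulr_ge0 //; first by lra.
have : X * s * L%:R <= 1 * L%:R by rewrite ler_wpM2r.
nra.
Qed.
End Cis.

(** * Sums over spaced points and Farey fractions *)

Section SpacedSums.
Variable R : realType.

Lemma sum_uniq_le_iota (F : nat -> R) (js : seq nat) (J : nat) :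
  (forall j, 0 <= F j) -> uniq js -> {in js, forall j, (j < J)%N} ->
  \sum_(j <- js) F j <= \sum_(0 <= j < J) F j.
Proof.
move=> F0 ujs jsJ.
have pe : perm_eq js [seq j <- index_iota 0 J | j \in js].
  apply: uniq_perm; rewrite ?filter_uniq ?iota_uniq // => j.
  rewrite mem_filter mem_index_iota /=.
  by case: (boolP (j \in js)) => // /jsJ ->.
rewrite (perm_big _ pe) big_filter big_mkcond /=.
by apply: ler_sum => j _; case: ifP => // _; exact: F0.
Qed.

(** Telescoping: [1 / (1 + c (j + 1)) ^ 2] is at most
    [(1 / c) (1 / (1 + c j) - 1 / (1 + c (j + 1)))]. *)
Lemma sum_inv_sqr_le (c : R) (J : nat) : 0 < c ->
  \sum_(0 <= j < J) (1 + c * j%:R) ^- 2 <= 1 + c^-1.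
Proof.
move=> c0.
suff H : \sum_(0 <= j < J.+1) (1 + c * j%:R) ^- 2
    <= 1 + c^-1 - c^-1 * (1 + c * J%:R)^-1.
  apply: le_trans (_ : \sum_(0 <= j < J.+1) (1 + c * j%:R) ^- 2 <= _).
    by rewrite big_nat_recr //= lerDl invr_ge0 sqr_ge0.
  apply: le_trans H _; rewrite gerBl mulr_ge0 ?invr_ge0 ?ltW //.
  by rewrite ltr_wpDr // mulr_ge0 // ltW.
elim: J => [|J IHJ].
  by rewrite big_nat1 mulr0 addr0 expr1n invr1 mulr1; lra.
rewrite big_nat_recr //=; apply: le_trans (lerD IHJ (lexx _)) _.
have d0 : 0 < 1 + c * J%:R by rewrite ltr_wpDr // mulr_ge0 // ltW.
have -> : 1 + c * J.+1%:R = 1 + c * J%:R + c by rewrite -natr1; ring.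
set d := 1 + _ in d0 *.
rewrite -addrA lerD2l addrC -subr_ge0.
have -> : - (c^-1 / (d + c)) - ((d + c) ^- 2 - c^-1 / d)
    = c / (d * (d + c) ^+ 2).
  by field; rewrite !gt_eqF //; lra.
have dc0 : 0 < d + c by lra.
by rewrite divr_ge0 ?mulr_ge0 ?sqr_ge0 ?ltW.
Qed.

(** Spaced points are told apart by the cell of length [delta] in which they
    lie; this is how spacing is used in all the counts below. *)
Lemma truncn_div_inj (T : eqType) (s : seq T) (g : T -> R) (delta : R) :
  0 < delta -> {in s, forall x, 0 <= g x} ->
  {in s &, forall x y, x != y -> delta <= `|g x - g y|} ->
  {in s &, injective (fun x => Num.truncn (g x / delta))}.
Proof.
move=> d0 g0 sep x y xs ys exy; apply/eqP; apply: contraT => /(sep _ _ xs ys).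
have /truncn_itv : 0 <= g x / delta by rewrite divr_ge0 ?g0 ?ltW.
have /truncn_itv : 0 <= g y / delta by rewrite divr_ge0 ?g0 ?ltW.
rewrite exy -[_.+1%:R]natr1; set j := (Num.truncn _)%:R.
rewrite !ler_pdivlMr // !ltr_pdivrMr // => /andP[y1 y2] /andP[x1 x2].
by rewrite leNgt ltr_norml => /negP[]; apply/andP; split; lra.
Qed.

(** Moving each point to the left end of its cell only increases the summand and
    reduces the sum to one over distinct integers. *)
Lemma spaced_sum_nonneg (T : eqType) (s : seq T) (g : T -> R) (delta L : R) :
  0 < delta -> 0 < L -> uniq s -> {in s, forall x, 0 <= g x} ->
  {in s &, forall x y, x != y -> delta <= `|g x - g y|} ->
  \sum_(x <- s) (1 + L * g x) ^- 2 <= 1 + (L * delta)^-1.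
Proof.
move=> d0 L0 us g0 sep; pose j x := Num.truncn (g x / delta).
apply: le_trans (_ : \sum_(x <- s) (1 + L * delta * (j x)%:R) ^- 2 <= _).
  rewrite big_seq [leRHS]big_seq; apply: ler_sum => x xs.
  have /truncn_itv/andP[+ _] : 0 <= g x / delta by rewrite divr_ge0 ?g0 ?ltW.
  rewrite -/(j x) ler_pdivlMr // => jx.
  have j0 : 0 <= L * delta * (j x)%:R.
    by rewrite mulr_ge0 ?mulr_ge0 ?(ltW L0) ?(ltW d0).
  have gx := g0 x xs.
  have jL : L * delta * (j x)%:R <= L * g x.
    by rewrite -mulrA ler_wpM2l ?(ltW L0) // mulrC.
  have Lj : 0 < 1 + L * delta * (j x)%:R by lra.
  have Lg : 0 < 1 + L * g x by lra.
  rewrite lef_pV2 ?posrE ?exprn_gt0 // lerXn2r ?nnegrE ?(ltW Lj) ?(ltW Lg) //.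
  by rewrite lerD2l.
rewrite -(big_map j predT (fun i => (1 + L * delta * i%:R) ^- 2)).
pose J := (\max_(x <- s) j x).+1.
apply: le_trans (sum_uniq_le_iota (J := J) _ _ _) (sum_inv_sqr_le J _).
- by move=> i; rewrite invr_ge0 sqr_ge0.
- by rewrite map_inj_in_uniq //; exact: truncn_div_inj.
- by move=> i /mapP[x xs ->]; rewrite ltnS; exact: leq_bigmax_seq.
- by rewrite mulr_gt0.
Qed.

Lemma spaced_sum (T : eqType) (s : seq T) (g : T -> R) (delta L : R) :
  0 < delta -> 0 < L -> uniq s ->
  {in s &, forall x y, x != y -> delta <= `|g x - g y|} ->
  \sum_(x <- s) (1 + L * `|g x|) ^- 2 <= 2 * (1 + (L * delta)^-1).
Proof.
move=> d0 L0 us sep.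
set B := 1 + _; have -> : 2 * B = B + B by ring.
rewrite (bigID (fun x => 0 <= g x)) /=.
rewrite -[X in X + _]big_filter -[X in _ + X]big_filter.
have sep' h : {in [seq x <- s | h x] &,
    forall x y, x != y -> delta <= `|g x - g y|}.
  move=> x y; rewrite !mem_filter => /andP[_ xs] /andP[_ ys]; exact: sep.
apply: lerD.
  rewrite big_seq (eq_bigr (fun x => (1 + L * g x) ^- 2)) => [|x]; last first.
    by rewrite mem_filter => /andP[gx _]; rewrite ger0_norm.
  rewrite -big_seq; apply: spaced_sum_nonneg => //; rewrite ?filter_uniq //.
    by move=> x; rewrite mem_filter => /andP[].
rewrite big_seq (eq_bigr (fun x => (1 + L * - g x) ^- 2)) => [|x]; last first.
  by rewrite mem_filter -ltNge => /andP[gx _]; rewrite ltr0_norm.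
rewrite -big_seq; apply: (@spaced_sum_nonneg _ _ (fun x => - g x)) => //.
- by rewrite filter_uniq.
- by move=> x; rewrite mem_filter -ltNge => /andP[gx _]; rewrite oppr_ge0 ltW.
- move=> x y xs ys xy; rewrite -opprD normrN.
  exact: (sep' (fun x => ~~ (0 <= g x)) x y xs ys xy).
Qed.

End SpacedSums.

Section Farey.
Variable R : realType.
Implicit Types (x y : rat).

Lemma farey_ratr (Q : nat) x : farey Q x ->
  exists p q : nat, [/\ (1 <= q <= Q)%N, (p < q)%N,
    x = p%:R / q%:R & ratr x = p%:R / q%:R :> R].
Proof.
move=> [p [q [qQ pq _ ->]]]; exists p, q; split=> //.
by rewrite fmorph_div /= !ratr_nat.
Qed.

Lemma farey_itv (Q : nat) x : farey Q x -> 0 <= (ratr x : R) < 1.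
Proof.
move=> /farey_ratr[p [q [/andP[q0 _] pq _ ->]]].
by rewrite divr_ge0 //= ltr_pdivrMr ?ltr0n // mul1r ltr_nat.
Qed.

(** The numerator of the difference is a non-zero integer and its denominator is
    at most [Q ^ 2]. *)
Lemma farey_spacing (Q : nat) x y : farey Q x -> farey Q y -> x != y ->
  Q%:R ^- 2 <= `|ratr x - ratr y| :> R.
Proof.
move=> /farey_ratr[p [q [/andP[q0 qQ] _ ex ->]]].
move=> /farey_ratr[p' [q' [/andP[q'0 q'Q] _ ey ->]]] xy.
have qR : 0 < q%:R :> R by rewrite ltr0n.
have qR' : 0 < q'%:R :> R by rewrite ltr0n.
have ne : (p * q' != p' * q)%N.
  apply: contra xy => /eqP e; rewrite ex ey eqr_div ?pnatr_eq0 -?lt0n //.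
  by rewrite -!natrM e.
have -> : p%:R / q%:R - p'%:R / q'%:R
    = ((p * q')%:Z - (p' * q)%:Z)%:~R / (q%:R * q'%:R) :> R.
  rewrite rmorphB /= -!pmulrn !natrM; field.
  by rewrite !gt_eqF.
rewrite normrM normfV [`|q%:R * _|]gtr0_norm ?mulr_gt0 //.
rewrite ler_pdivlMr ?mulr_gt0 // -intr_norm.
have h1 : 1 <= `|(p * q')%:Z - (p' * q)%:Z| :> int.
  by rewrite -gtz0_ge1 normr_gt0 subr_eq0 eqz_nat.
apply: le_trans (_ : 1 <= _); last by rewrite -(ler_int R) in h1.
rewrite mulrC ler_pdivrMr ?mul1r ?exprn_gt0 ?ltr0n ?(leq_trans q0) //.
by rewrite expr2 ler_pM ?ler_nat.
Qed.

End Farey.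

(** * The large sieve for a dilated set of points *)

Section LargeSieve.
Variable R : realType.
Import Normc.

Lemma sqr_normc_sum (I : Type) (r : seq I) (z : I -> R[i]) :
  (normc (\sum_(i <- r) z i) ^+ 2)%:C%C
  = \sum_(i <- r) \sum_(j <- r) z i * ((z j)^*)%C.
Proof.
rewrite sqr_normc rmorph_sum mulr_suml; apply: eq_bigr => i _.
by rewrite mulr_sumr.
Qed.

(** Expanding each square and summing over [x] first: only differences of the
    frequencies [Y] survive. *)
Lemma expand_square_sum (I J : Type) (s : seq I) (r : seq J)
    (X : I -> R) (Y : J -> R) (c : J -> R[i]) :
  (\sum_(x <- s) normc (\sum_(n <- r) c n * e2pi (X x * Y n)) ^+ 2)%:C%C
  = \sum_(n <- r) \sum_(m <- r)
      c n * ((c m)^*)%C * \sum_(x <- s) e2pi (X x * (Y n - Y m)).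
Proof.
rewrite rmorph_sum; under eq_bigr do rewrite /= sqr_normc_sum.
rewrite exchange_big; apply: eq_bigr => n _.
rewrite exchange_big; apply: eq_bigr => m _.
rewrite mulr_sumr; apply: eq_bigr => x _.
by rewrite mulrBr e2piD e2piN rmorphM /= mulrACA.
Qed.

Lemma square_sum_le (I J : Type) (s : seq I) (r : seq J)
    (X : I -> R) (Y : J -> R) (c : J -> R[i]) :
  \sum_(x <- s) normc (\sum_(n <- r) c n * e2pi (X x * Y n)) ^+ 2
  <= \sum_(n <- r) \sum_(m <- r) normc (c n) * normc (c m) *
       normc (\sum_(x <- s) e2pi (X x * (Y n - Y m))).
Proof.
set S := \sum_(x <- s) _.
have S0 : 0 <= S by apply: sumr_ge0 => x _; exact: sqr_ge0.
rewrite -(ger0_norm S0) -normc_real expand_square_sum.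
apply: le_trans (normc_sum _ _ _) (ler_sum _ _) => n _.
apply: le_trans (normc_sum _ _ _) (ler_sum _ _) => m _.
rewrite !normcM; set w := c m; have -> // : normc (w^*)%C = normc w.
by case: w => a b; rewrite /= sqrrN.
Qed.

Lemma dirichlet_square (L : nat) (t : R) :
  \sum_(0 <= i < L) \sum_(0 <= j < L) e2pi ((j%:R - i%:R) * t)
  = (normc (dirichlet L t) ^+ 2)%:C%C.
Proof.
rewrite sqr_normc_sum exchange_big.
apply: eq_bigr => j _; apply: eq_bigr => i _.
by rewrite mulrBl e2piD e2piN.
Qed.

(** Duality between the two families of variables, obtained by reading
    [expand_square_sum] with the pairs [(i, j)] as points and the elements of
    [s] as frequencies. *)
Lemma exchange_squares (I : Type) (s : seq I) (X : I -> R) (kappa : R)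
    (L : nat) :
  \sum_(0 <= i < L) \sum_(0 <= j < L)
     normc (\sum_(x <- s) e2pi (X x * (kappa * (j%:R - i%:R)))) ^+ 2
  = \sum_(x <- s) \sum_(y <- s)
     normc (dirichlet L (kappa * (X x - X y))) ^+ 2.
Proof.
apply: (@complexI R).
pose pairs := [seq (i, j) | i <- index_iota 0 L, j <- index_iota 0 L].
have := @expand_square_sum _ _ pairs s (fun p => p.2%:R - p.1%:R)
  (fun x => kappa * X x) (fun=> 1).
rewrite big_allpairs => H.
rewrite -[RHS]/(real_complex R _) !rmorph_sum.
transitivity (\sum_(x <- s) \sum_(y <- s)
   (\sum_(0 <= i < L) \sum_(0 <= j < L)
      e2pi ((j%:R - i%:R) * (kappa * (X x - X y))) : R[i])).
  rewrite -rmorph_sum.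
  transitivity ((\sum_(0 <= i < L) \sum_(0 <= j < L)
    normc (\sum_(x <- s) 1 * e2pi ((j%:R - i%:R) * (kappa * X x))) ^+ 2)%:C)%C.
    congr (_%:C)%C; apply: eq_bigr => i _; apply: eq_bigr => j _.
    congr (normc _ ^+ 2); apply: eq_bigr => x _.
    by rewrite mul1r; congr e2pi; ring.
  apply: etrans H _; apply: eq_bigr => x _; apply: eq_bigr => y _.
  rewrite conjc1 !mul1r big_allpairs /=.
  apply: eq_bigr => i _; apply: eq_bigr => j _.
  by rewrite [kappa * (_ - _)]mulrBr.
apply: eq_bigr => x _; rewrite rmorph_sum; apply: eq_bigr => y _.
exact: dirichlet_square.
Qed.

(** Summing the majorant over all the integers that can be nearest to [t] makes
    the bound independent of which of them is; this replaces the distance to the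
    nearest integer by ordinary distances. *)
Lemma dirichlet_le_sum (L P : nat) (t : R) : `|t| <= P%:R ->
  normc (dirichlet L t) ^+ 2 <= \sum_(0 <= i < P.*2.+1)
    4 * L%:R ^+ 2 * (1 + L%:R * `|t - (i%:R - P%:R)|) ^- 2.
Proof.
rewrite ler_norml => /andP[tl tu].
(* The integer nearest to [t]. *)
pose m := Num.floor (t + 1 / 2).
have /andP[m1 m2] := floor_itv (t + 1 / 2).
rewrite -/m rmorphD /= in m1 m2.
have mP : m <= P%:Z.
  rewrite -ltzD1 -(ltr_int R) rmorphD /= -pmulrn; lra.
have mP' : - P%:Z <= m.
  rewrite -ltzD1 -(ltr_int R) rmorphD rmorphN /= -pmulrn; lra.
pose i := absz (m + P%:Z).
have ei : i%:Z = m + P%:Z by rewrite /i gez0_abs; lia.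
have mi : m%:~R = i%:R - P%:R :> R.
  by rewrite !pmulrn ei rmorphD /= addrK.
rewrite (bigD1_seq i) ?iota_uniq //=; last first.
  by rewrite mem_index_iota; lia.
rewrite -mi -[leLHS]addr0 lerD //.
  by apply: dirichlet_le; rewrite ler_norml; apply/andP; split; lra.
by apply: sumr_ge0 => j _; rewrite !mulr_ge0 ?invr_ge0 ?sqr_ge0.
Qed.

(** After [dirichlet_le_sum], each of the at most [2 kappa + 3] integers sees a
    [kappa delta]-spaced family, to which [spaced_sum] applies. *)
Lemma dirichlet_spaced_sum (T : eqType) (s : seq T) (X : T -> R)
    (kappa delta : R) (L : nat) (x : T) :
  0 < kappa -> 0 < delta -> (0 < L)%N -> uniq s ->
  {in s, forall y, 0 <= X y < 1} ->
  {in s &, forall y z, y != z -> delta <= `|X y - X z|} ->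
  x \in s ->
  \sum_(y <- s) normc (dirichlet L (kappa * (X x - X y))) ^+ 2
  <= 8 * (2 * kappa + 3) * (L%:R ^+ 2 + L%:R / (kappa * delta)).
Proof.
move=> k0 d0 L0 us X01 sep xs; pose P := (Num.truncn kappa).+1.
have LR : 0 < L%:R :> R by rewrite ltr0n.
have kd : 0 < kappa * delta by rewrite mulr_gt0.
pose H (i : nat) (y : T) :=
  (1 + L%:R * `|kappa * (X x - X y) - (i%:R - P%:R)|) ^- 2.
apply: (@le_trans _ _ (\sum_(y <- s) \sum_(0 <= i < P.*2.+1)
    4 * L%:R ^+ 2 * H i y)).
  rewrite big_seq [leRHS]big_seq; apply: ler_sum => y ys.
  apply: dirichlet_le_sum.
  apply: le_trans (_ : kappa <= _); last exact: ltW (truncnS_gt _).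
  have /andP[x1 x2] := X01 _ xs; have /andP[y1 y2] := X01 _ ys.
  by rewrite normrM gtr0_norm // ger_pMr // ler_norml; apply/andP; split; lra.
rewrite exchange_big /=.
apply: (@le_trans _ _ (\sum_(0 <= i < P.*2.+1)
    4 * L%:R ^+ 2 * (2 * (1 + (L%:R * (kappa * delta))^-1)))).
  apply: ler_sum => i _; rewrite -mulr_sumr ler_wpM2l ?mulr_ge0 ?sqr_ge0 //.
  apply: spaced_sum => // y z ys zs yz.
  have -> : kappa * (X x - X y) - (i%:R - P%:R)
      - (kappa * (X x - X z) - (i%:R - P%:R)) = kappa * (X z - X y) by ring.
  by rewrite normrM gtr0_norm // ler_pM2l // sep // eq_sym.
rewrite sumr_const_nat subn0 -[leLHS]mulr_natr.
have -> : 4 * L%:R ^+ 2 * (2 * (1 + (L%:R * (kappa * delta))^-1))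
    = 8 * (L%:R ^+ 2 + L%:R / (kappa * delta)) :> R.
  by field; rewrite !gt_eqF.
rewrite mulrAC ler_wpM2r //.
  by rewrite addr_ge0 ?sqr_ge0 // divr_ge0 ?(ltW kd).
rewrite ler_wpM2l //.
have /andP[tk _] := truncn_itv (ltW k0).
have -> : P.*2.+1%:R = 2 * (Num.truncn kappa)%:R + 3 :> R.
  by rewrite -natrM -natrD /P; congr (_%:R); lia.
lra.
Qed.

(** For [k >= 0] the pairs [(i, i + k)] with [i <= K] all qualify; the case
    [k < 0] follows by exchanging [i] and [j]. *)
Lemma count_differences (K : nat) (k : int) : (`|k| <= K)%N ->
  K.+1%:R <= \sum_(0 <= i < K.*2.+1) \sum_(0 <= j < K.*2.+1)
                (j%:Z - i%:Z == k)%:R :> R.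
Proof.
wlog k0 : k / 0 <= k.
  move=> H; case: (lerP 0 k) => [|k0]; first exact: H.
  rewrite -abszN => /H H'; rewrite exchange_big; apply: le_trans (H' _) _.
    by rewrite oppr_ge0 ltW.
  apply: ler_sum => i _; apply: ler_sum => j _; rewrite ler_nat.
  by case: (eqVneq (j%:Z - i%:Z) (- k)) => //= e;
     have -> : i%:Z - j%:Z == k by apply/eqP; lia.
move=> kK; rewrite (big_cat_nat (n := K.+1)) //=; last by lia.
have H0 i : 0 <= \sum_(0 <= j < K.*2.+1) (j%:Z - i%:Z == k)%:R :> R.
  by apply: sumr_ge0.
rewrite -[leLHS]addr0 lerD ?sumr_ge0 //.
have -> : K.+1%:R = \sum_(0 <= i < K.+1) (1 : R).
  by rewrite sumr_const_nat subn0.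
rewrite [leLHS]big_nat [leRHS]big_nat; apply: ler_sum => i /= iK.
rewrite (bigD1_seq (i + `|k|)%N) ?iota_uniq //=; last first.
  by rewrite mem_index_iota; lia.
have -> : (i + `|k|)%N%:Z - i%:Z == k by apply/eqP; lia.
by rewrite lerDl sumr_ge0.
Qed.

End LargeSieve.

(** * Pairs of integers and their frequencies *)

Section Pairs.
Variable R : realType.

(** Replaces a sum over pairs, known only through the multiplicities of the
    values [kk p], by a sum over all differences.  The sum over [k] itself never
    appears: each [t (kk p)] is spread over the at least [K + 1] ways of writing
    [kk p] as a difference, and the order of summation is exchanged. *)
Lemma sum_multiplicity_le (I : eqType) (r : seq I) (kk : I -> int)
    (t : int -> R) (K : nat) (D : R) :
  (forall k, 0 <= t k) -> {in r, forall p, `|kk p| <= K}%N -> 0 <= D ->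
  (forall k : int, k != 0 -> (`|k| <= K.*2)%N ->
    \sum_(p <- r) (kk p == k)%:R <= D) ->
  K.+1%:R * \sum_(p <- r | kk p != 0) t (kk p)
  <= D * \sum_(0 <= i < K.*2.+1) \sum_(0 <= j < K.*2.+1) t (j%:Z - i%:Z).
Proof.
move=> t0 kK D0 mult.
apply: (@le_trans _ _ (\sum_(p <- r | kk p != 0)
   \sum_(0 <= i < K.*2.+1) \sum_(0 <= j < K.*2.+1)
      (j%:Z - i%:Z == kk p)%:R * t (j%:Z - i%:Z))).
  rewrite mulr_sumr big_seq_cond [leRHS]big_seq_cond.
  apply: ler_sum => p /andP[pr _].
  apply: le_trans (ler_wpM2r (t0 _) (count_differences R (kK p pr))) _.
  rewrite mulr_suml; apply: ler_sum => i _; rewrite mulr_suml.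
  by apply: ler_sum => j _; case: eqP => [->//|_]; rewrite !mul0r.
rewrite exchange_big mulr_sumr big_nat [leRHS]big_nat.
apply: ler_sum => i iK; rewrite exchange_big mulr_sumr big_nat [leRHS]big_nat.
apply: ler_sum => j jK /=; rewrite -mulr_suml ler_wpM2r //.
have [-> | ji0] := eqVneq (j%:Z - i%:Z) 0.
  by rewrite big1 // => p; rewrite eq_sym => /negPf ->.
have jiK : (`|(j%:Z - i%:Z)%R| <= K.*2)%N.
  by move: iK jK => /andP[_ iK] /andP[_ jK]; lia.
apply: le_trans _ (mult _ ji0 jiK).
rewrite big_mkcond /=; apply: ler_sum => p _; rewrite [kk p == j%:Z - _]eq_sym.
by case: ifP.
Qed.

(** A representation is determined by [n - m], which divides [k] up to sign: the
    cofactor then gives [n + m] because [b <> 0]. *)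
Lemma count_representations (r : seq int) (a b k : int) :
  uniq r -> 0 < b -> k != 0 ->
  \sum_(p <- [seq (n, m) | n <- r, m <- r])
     ((p.1 - p.2) * (b * (p.1 + p.2) + a) == k)%:R
  <= 2 * (size (divisors `|k|))%:R :> R.
Proof.
move=> ur b0 k0; set rr := [seq (n, m) | n <- r, m <- r].
have urr : uniq rr by apply: allpairs_uniq => // -[? ?] [? ?] _ _.
rewrite -natr_sum -natrM ler_nat.
pose q (p : int * int) := (p.1 - p.2) * (b * (p.1 + p.2) + a) == k.
have -> : (\sum_(p <- rr) q p = size [seq p <- rr | q p])%N.
  rewrite size_filter -sum1_count [RHS]big_mkcond.
  by apply: eq_bigr => p _; case: (q p).
rewrite -(size_map (fun p => p.1 - p.2)).
pose ds := [seq d%:Z | d <- divisors `|k|].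
have -> : (2 * size (divisors `|k|) = size (ds ++ map -%R ds))%N.
  by rewrite size_cat !size_map; lia.
apply: uniq_leq_size.
  rewrite map_inj_in_uniq ?filter_uniq // => -[n m] [n' m'].
  rewrite !mem_filter /q /= => /andP[/eqP e _] /andP[/eqP e' _] dd.
  have nm0 : n' - m' != 0.
    by apply: contra k0 => /eqP nm; rewrite -e' nm mul0r.
  rewrite -e' dd in e; have/(mulfI nm0)/addIr/(mulfI (lt0r_neq0 b0)) ee := e.
  by congr pair; lia.
move=> d /mapP[[n m]]; rewrite mem_filter /q /= => /andP[/eqP e _] ->.
have : `|n - m|%N \in divisors `|k|.
  rewrite -dvdn_divisors ?absz_gt0 //.
  by apply/dvdnP; exists (absz (b * (n + m) + a)); rewrite -e abszM mulnC.
rewrite mem_cat => dv; apply/orP.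
have nm : `|n - m|%N%:Z \in ds by apply/mapP; exists `|n - m|%N.
have [h|h] := lerP 0 (n - m).
  by left; move: nm; rewrite gez0_abs.
right; apply/mapP; exists (`|n - m|%N%:Z) => //.
by rewrite ltz0_abs // opprK.
Qed.

(** By Lagrange's identity. *)
Lemma cauchy_schwarz_seq (I : Type) (r : seq I) (P : pred I) (x y : I -> R) :
  (\sum_(i <- r | P i) x i * y i) ^+ 2
  <= (\sum_(i <- r | P i) x i ^+ 2) * \sum_(i <- r | P i) y i ^+ 2.
Proof.
rewrite -subr_ge0.
suff -> : (\sum_(i <- r | P i) x i ^+ 2) * (\sum_(i <- r | P i) y i ^+ 2)
    - (\sum_(i <- r | P i) x i * y i) ^+ 2
  = 2^-1 * \sum_(i <- r | P i) \sum_(j <- r | P j) (x i * y j - x j * y i) ^+ 2.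
  apply: mulr_ge0; rewrite ?invr_ge0 //.
  by do 2!apply: sumr_ge0 => ? _; exact: sqr_ge0.
transitivity (2^-1 * \sum_(i <- r | P i) \sum_(j <- r | P j)
   ((x i ^+ 2 * y j ^+ 2 + y i ^+ 2 * x j ^+ 2)
      - 2 * ((x i * y i) * (x j * y j)))); last first.
  by congr (_ * _); apply: eq_bigr => i _; apply: eq_bigr => j _; ring.
have e i : \sum_(j <- r | P j) (x i ^+ 2 * y j ^+ 2 + y i ^+ 2 * x j ^+ 2
      - 2 * ((x i * y i) * (x j * y j)))
    = x i ^+ 2 * (\sum_(j <- r | P j) y j ^+ 2)
      + y i ^+ 2 * (\sum_(j <- r | P j) x j ^+ 2)
      - 2 * ((x i * y i) * \sum_(j <- r | P j) x j * y j).
  by rewrite sumrB big_split /= !mulr_sumr.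
rewrite (eq_bigr _ (fun i _ => e i)) sumrB big_split /= -!mulr_suml -mulr_sumr.
rewrite -mulr_suml.
by field.
Qed.

(** By symmetry, [w n * w m <= (w n ^ 2 + w m ^ 2) / 2] allows charging each
    pair to its first element alone. *)
Lemma sym_pairs_le (r : seq int) (q : rel int) (w : int -> R) (d : nat) :
  symmetric q -> (forall n, n \in r -> (count (q n) r <= d)%N) ->
  \sum_(n <- r) \sum_(m <- r | q n m) w n * w m
  <= d%:R * \sum_(n <- r) w n ^+ 2.
Proof.
move=> qs qd.
apply: (@le_trans _ _ (\sum_(n <- r) \sum_(m <- r | q n m) w n ^+ 2)).
  have e : \sum_(n <- r) \sum_(m <- r | q n m) w n ^+ 2
      = \sum_(n <- r) \sum_(m <- r | q n m) w m ^+ 2.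
    rewrite (exchange_big_dep predT) //=; apply: eq_bigr => n _.
    by apply: eq_bigl => m; rewrite qs.
  have -> : \sum_(n <- r) \sum_(m <- r | q n m) w n ^+ 2
      = \sum_(n <- r) \sum_(m <- r | q n m) (w n ^+ 2 + w m ^+ 2) / 2.
    under [RHS]eq_bigr do rewrite -mulr_suml big_split /=.
    by rewrite -mulr_suml big_split /= -e; field.
  apply: ler_sum => n _; apply: ler_sum => m _.
  by have := sqr_ge0 (w n - w m); nra.
rewrite mulr_sumr big_seq [leRHS]big_seq; apply: ler_sum => n nr.
rewrite big_const_seq iter_addr_0 -[leLHS]mulr_natl ler_wpM2r ?sqr_ge0 //.
by rewrite ler_nat qd.
Qed.

(** Besides [m = n], the only solution is the reflection of [n] in the vertex
    [- a / (2 b)] of the parabola [b x ^ 2 + a x]. *)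
Lemma count_diagonal (r : seq int) (a b n : int) : uniq r -> 0 < b ->
  (count (fun m => (n - m) * (b * (n + m) + a) == 0)%R r <= 2)%N.
Proof.
move=> ur b0; rewrite -size_filter; set s := seq.filter _ _.
have us : uniq s by rewrite filter_uniq.
have eqs m : m \in s -> m != n -> b * (n + m) + a = 0.
  rewrite mem_filter mulf_eq0 subr_eq0 => /andP[/orP[/eqP ->|/eqP //]].
  by rewrite eqxx.
have us' : uniq [seq m <- s | m != n] by rewrite filter_uniq.
have : (size [seq m <- s | m != n] <= 1)%N.
  case e : [seq m <- s | m != n] us' => [|m1 [|m2 l]] //= /andP[+ _].
  rewrite inE => /norP[m12 _].
  have : m1 \in [seq m <- s | m != n] by rewrite e !inE eqxx.
  have : m2 \in [seq m <- s | m != n] by rewrite e !inE eqxx orbT.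
  rewrite ![_ \in [seq _ <- s | _]]mem_filter.
  move=> /andP[n2 /eqs/(_ n2) e2] /andP[n1 /eqs/(_ n1) e1].
  have /addIr/(mulfI (lt0r_neq0 b0))/addrI em :
      b * (n + m1) + a = b * (n + m2) + a.
    by rewrite e1 e2.
  by rewrite em eqxx in m12.
rewrite size_filter => h; rewrite -(count_predC (pred1 n) s).
rewrite (count_uniq_mem n us) (eq_count (a2 := fun m => m != n)) //.
by case: (n \in s); lia.
Qed.

End Pairs.

(** * The sieve over Farey fractions *)

Section FareyQuadratic.
Variable R : realType.
Import Normc.

(** The bound is the trivial one, but it comes here from the spacing: the
    fractions lie in distinct cells of length [Q ^ -2] of the unit interval. *)
Lemma size_farey (Q : nat) (s : seq rat) :
  (0 < Q)%N -> uniq s -> {in s, forall x, farey Q x} -> (size s <= Q ^ 2)%N.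
Proof.
move=> Q0 us sQ.
have QR : 0 < Q%:R :> R by rewrite ltr0n.
pose j (x : rat) := Num.truncn ((ratr x : R) / Q%:R ^- 2).
rewrite -(size_map j) -(size_iota 0 (Q ^ 2)); apply: uniq_leq_size.
  rewrite map_inj_in_uniq //; apply: truncn_div_inj.
  - by rewrite invr_gt0 exprn_gt0.
  - by move=> x /sQ /(farey_itv R)/andP[].
  - by move=> x y /sQ xs /sQ ys; exact: farey_spacing.
move=> i /mapP[x /sQ /(farey_itv R)/andP[x0 x1] ->].
rewrite mem_iota add0n leq0n /= /j invrK.
have xQ0 : 0 <= ratr x * Q%:R ^+ 2 :> R by rewrite mulr_ge0 ?exprn_ge0.
by rewrite truncn_lt_nat // natrX gtr_pMl ?exprn_gt0.
Qed.

Lemma farey_dirichlet_sum (Q L : nat) (s : seq rat) (kappa : R) :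
  (0 < Q)%N -> (0 < L)%N -> 0 < kappa -> uniq s ->
  {in s, forall x, farey Q x} ->
  \sum_(x <- s) \sum_(y <- s)
     normc (dirichlet L (kappa * (ratr x - ratr y))) ^+ 2
  <= Q%:R ^+ 2 *
     (8 * (2 * kappa + 3) * (L%:R ^+ 2 + L%:R * Q%:R ^+ 2 / kappa)).
Proof.
move=> Q0 L0 k0 us sQ.
have QR : 0 < Q%:R :> R by rewrite ltr0n.
set B := 8 * _ * _.
have B0 : 0 <= B.
  rewrite !mulr_ge0 ?addr_ge0 ?divr_ge0 ?mulr_ge0 ?exprn_ge0 //; lra.
apply: (@le_trans _ _ (\sum_(x <- s) B)).
  rewrite big_seq [leRHS]big_seq; apply: ler_sum => x xs.
  have d0 : 0 < Q%:R ^- 2 :> R by rewrite invr_gt0 exprn_gt0.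
  apply: le_trans (dirichlet_spaced_sum (delta := Q%:R ^- 2) k0 d0 L0 us _ _ xs)
    _ => [y /sQ|y z /sQ ys /sQ zs|]; first exact: farey_itv.
    exact: farey_spacing.
  have -> : L%:R / (kappa * Q%:R ^- 2) = L%:R * Q%:R ^+ 2 / kappa.
    by field; rewrite !gt_eqF.
  exact: lexx.
rewrite big_const_seq count_predT iter_addr_0 -[leLHS]mulr_natl.
by rewrite ler_wpM2r // -natrX ler_nat (size_farey Q0).
Qed.

(** The inequality before constants are simplified: [D] stands for the divisor
    bound and [K] for any bound on the integer frequencies.  The first summand
    comes from the pairs with [kk n m = 0], the square root from the
    others. *)
Lemma farey_quadratic_sieve (Q K : nat) (s : seq rat) (r : seq int)
    (kappa D : R) (a b : int) (Y : int -> R) (c : int -> R[i]) :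
  let kk (n m : int) := (n - m) * (b * (n + m) + a) in
  (0 < Q)%N -> 0 < kappa -> 0 < b -> uniq s -> {in s, forall x, farey Q x} ->
  uniq r -> (forall n m, Y n - Y m = kappa * (kk n m)%:~R) ->
  {in r &, forall n m, `|kk n m| <= K}%N -> 0 <= D ->
  (forall k, (0 < k <= K.*2)%N -> (size (divisors k))%:R <= D) ->
  \sum_(x <- s) normc (\sum_(n <- r) c n * e2pi (ratr x * Y n)) ^+ 2
  <= (2 * Q%:R ^+ 2
      + Num.sqrt (32 * D * Q%:R ^+ 2 * (2 * kappa + 3)
                    * (K.*2.+1%:R + Q%:R ^+ 2 / kappa)))
     * \sum_(n <- r) normc (c n) ^+ 2.
Proof.
move=> kk Q0 k0 b0 us sQ ur Ykk kkK D0 divD.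
set Z := \sum_(n <- r) _.
have Z0 : 0 <= Z by apply: sumr_ge0 => n _; exact: sqr_ge0.
pose w n := normc (c n).
have w0 n : 0 <= w n by exact: normc_ge0.
pose g (k : int) := normc (\sum_(x <- s) e2pi (ratr x * (kappa * k%:~R))).
have g0 k : 0 <= g k by exact: normc_ge0.
pose rr := [seq (n, m) | n <- r, m <- r].
pose kp (p : int * int) := kk p.1 p.2.
apply: (@le_trans _ _ (\sum_(p <- rr) w p.1 * w p.2 * g (kp p))).
  rewrite big_allpairs /=; apply: le_trans (square_sum_le _ _ _ _ _) _.
  by apply: ler_sum => n _; apply: ler_sum => m _; rewrite /g /kp Ykk.
rewrite (bigID (fun p => kp p == 0)) /= mulrDl; apply: lerD.
  have gs : g 0 <= Q%:R ^+ 2.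
    apply: le_trans (normc_sum _ _ _) _.
    under eq_bigr do rewrite normc_e2pi.
    rewrite big_const_seq count_predT iter_addr_0 -natrX ler_nat.
    exact: size_farey.
  rewrite (eq_bigr (fun p => w p.1 * w p.2 * g 0)) => [|p /eqP -> //].
  rewrite -mulr_suml [leRHS]mulrAC; apply: ler_pM => //.
    by apply: sumr_ge0 => p _; rewrite mulr_ge0.
  rewrite big_mkcond big_allpairs /=.
  under eq_bigr do rewrite -big_mkcond /=.
  apply: (@sym_pairs_le R r (fun n m => kk n m == 0) w 2).
    move=> n m; have -> : kk n m = - kk m n by rewrite /kk; ring.
    by rewrite oppr_eq0.
  by move=> n _; exact: count_diagonal.
set S := \sum_(p <- rr | _) _.
have S0 : 0 <= S by apply: sumr_ge0 => p _; rewrite !mulr_ge0.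
set V := 32 * _ * _ * _ * _.
have QR : 0 < Q%:R :> R by rewrite ltr0n.
have V0 : 0 <= V.
  rewrite !mulr_ge0 ?addr_ge0 ?divr_ge0 ?mulr_ge0 ?exprn_ge0 //; lra.
suff SV : S ^+ 2 <= V * Z ^+ 2.
  rewrite -[S]ger0_norm // -sqrtr_sqr.
  rewrite -[X in _ * X]ger0_norm // -[X in _ * X]sqrtr_sqr.
  by rewrite -sqrtrM // ler_sqrt // mulr_ge0 ?sqr_ge0.
apply: le_trans (cauchy_schwarz_seq _ _ _ _) _.
rewrite mulrC; apply: ler_pM; try by apply: sumr_ge0 => p _; exact: sqr_ge0.
  have mult (k : int) : k != 0 -> (`|k| <= K.*2)%N ->
      \sum_(p <- rr) (kp p == k)%:R <= 2 * D.
    move=> kn0 kK; apply: le_trans (count_representations R a ur b0 kn0) _.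
    by rewrite ler_wpM2l // divD // absz_gt0 kn0.
  have kpK : {in rr, forall p, `|kp p| <= K}%N.
    by move=> p /allpairsP[[n m] [nr mr ->]]; exact: kkK.
  have D20 : 0 <= 2 * D by rewrite mulr_ge0.
  have := sum_multiplicity_le (t := fun k => g k ^+ 2) (fun k => sqr_ge0 _)
    kpK D20 mult.
  have -> : \sum_(0 <= i < K.*2.+1) \sum_(0 <= j < K.*2.+1) g (j%:Z - i%:Z) ^+ 2
     = \sum_(x <- s) \sum_(y <- s)
         normc (dirichlet K.*2.+1 (kappa * (ratr x - ratr y))) ^+ 2.
    rewrite -exchange_squares; apply: eq_bigr => i _; apply: eq_bigr => j _.
    by rewrite /g rmorphB.
  have := farey_dirichlet_sum Q0 (ltn0Sn K.*2) k0 us sQ.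
  set A := \sum_(x <- s) _; set W := \sum_(p <- rr | _) _ => hA hW.
  (* The window [L = 2 K + 1] is less than twice [K + 1], so that dividing by
     [K + 1] costs one power of [L] only. *)
  have K0 : 0 < K.+1%:R :> R by rewrite ltr0n.
  rewrite -(ler_pM2l K0); apply: le_trans hW _.
  apply: le_trans (ler_wpM2l D20 hA) _.
  have -> : 2 * D * (Q%:R ^+ 2 * (8 * (2 * kappa + 3) *
        (K.*2.+1%:R ^+ 2 + K.*2.+1%:R * Q%:R ^+ 2 / kappa)))
      = K.*2.+1%:R * (2^-1 * V) by rewrite /V; field; rewrite gt_eqF.
  have -> : K.+1%:R * V = (2 * K.+1%:R) * (2^-1 * V) by field.
  apply: ler_wpM2r; first by rewrite mulr_ge0.
  by rewrite -natrM ler_nat mul2n doubleS.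
rewrite big_mkcond big_allpairs /= expr2 mulr_suml.
apply: ler_sum => n _; rewrite mulr_sumr; apply: ler_sum => m _.
by case: ifP => _; rewrite ?exprMn // mulr_ge0 ?sqr_ge0.
Qed.

End FareyQuadratic.

(** * The theorem *)

(** Uses [|n - m| <= N] and [|n + m| <= 2 (|M| + N)]. *)
Lemma quadratic_frequency_bound (M n m a b : int) (N K : nat) : 0 < b ->
  K%:Z = N%:Z * (2 * b * (`|M| + N%:Z) + `|a|) ->
  M < n <= M + N%:Z -> M < m <= M + N%:Z ->
  (absz ((n - m) * (b * (n + m) + a))%R <= K)%N.
Proof.
move=> b0 eK nM mM; rewrite -lez_nat eK abszE normrM.
apply: ler_pM => //; first by lia.
apply: le_trans (ler_normD _ _) _; rewrite lerD2r normrM gtr0_norm //.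
have : `|n + m| <= 2 * (`|M| + N%:Z) by lia.
by move=> h; rewrite mulrAC [X in _ <= X]mulrC ler_wpM2l // ltW.
Qed.

(** The hypothesis that [beta / alpha] is rational enters here only: it makes
    all the frequencies integer multiples of [alpha / b]. *)
Lemma quadf_difference (R : realType) (alpha beta gamma : R) (a b n m : int) :
  0 < alpha -> 0 < b -> beta / alpha = a%:~R / b%:~R ->
  quadf alpha beta gamma n%:~R - quadf alpha beta gamma m%:~R
  = alpha / b%:~R * ((n - m) * (b * (n + m) + a))%:~R.
Proof.
move=> al0 b0 eab.
have bR : (b%:~R : R) != 0 by rewrite intr_eq0 gt_eqF.
have -> : beta = a%:~R / b%:~R * alpha by rewrite -eab divfK // gt_eqF.
by rewrite /quadf !(rmorphM, rmorphD, rmorphN) /=; field.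
Qed.

Theorem theorem2 (R : realType) (eps : R) (eps_gt0 : 0 < eps) :
  exists2 C : R, 0 < C &
  forall (Q : nat) (M : int) (N : nat) (alpha beta gamma : R) (a b : int)
    (u : int -> R[i]),
    (1 <= Q)%N -> (0 < N)%N -> 0 < alpha ->
    0 < b -> coprimez a b -> beta / alpha = a%:~R / b%:~R ->
    \sum_(x \in farey Q)
      Normc.normc
        (\sum_(1 <= k < N.+1)
           u (M + k%:Z) *
           e2pi (ratr x * quadf alpha beta gamma (M + k%:Z)%:~R)) ^+ 2
    <= C *
       (Q%:R ^+ 2 +
        Q%:R * Num.sqrt (alpha * N%:R *
                  (`|M%:~R| + N%:R + `|a%:~R| / b%:~R) + 1)) *
       PiFactor eps alpha M N a b * ZFactor M N u.
Proof.
have [C0 C0_gt0 divC] := divisor_bound eps_gt0.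
(* [576 = 32 * 18]: the factor 32 comes from [farey_quadratic_sieve], and
   [18 = 3 * 3 * 2] from comparing [2 kappa + 3] with [3 (kappa + 1)], [2 K + 1]
   with [3 K] and [kappa K] with [2 Y]; and [6] bounds [2 K / B ^ 2]. *)
pose C1 : R := 576 * C0 * 6 `^ eps.
have C1_ge0 : 0 <= C1.
  exact: mulr_ge0 (mulr_ge0 (ler0n _ _) (ltW C0_gt0)) (powR_ge0 _ _).
exists (2 + Num.sqrt C1); first by rewrite ltr_wpDr ?sqrtr_ge0.
move=> Q M N alpha beta gamma a b u Q0 N0 al0 b0 _ eab.
have bR : 1 <= b%:~R :> R by rewrite ler1z -gtz0_ge1.
have b_gt0 : 0 < b%:~R :> R by apply: lt_le_trans bR.
have QR : 0 < Q%:R :> R by rewrite ltr0n.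
have NR : 1 <= N%:R :> R by rewrite ler1n.
pose kappa := alpha / b%:~R.
have k0 : 0 < kappa by rewrite divr_gt0.
set t := `|M%:~R| + N%:R.
have t1 : 1 <= t by rewrite -[1]add0r lerD.
set a' := `|a%:~R|.
have a'0 : 0 <= a' := normr_ge0 _.
pose Y := alpha * N%:R * (t + a' / b%:~R).
have Y0 : 0 <= Y.
  by rewrite !mulr_ge0 ?addr_ge0 ?divr_ge0 ?(ltW al0) ?(ltW b_gt0) //; lra.
rewrite -/Y; set E := Q%:R ^+ 2 + _.
pose K := absz (N%:Z * (2 * b * (`|M| + N%:Z) + `|a|)).
have eK : K%:Z = N%:Z * (2 * b * (`|M| + N%:Z) + `|a|).
  by rewrite /K gez0_abs // !(mulr_ge0, addr_ge0) // ltW.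
have KR : K%:R = N%:R * (2 * b%:~R * t + a') :> R.
  by rewrite pmulrn eK !(rmorphM, rmorphD) /= !intr_norm.
have bt : 1 <= b%:~R * t by nra.
have K1 : (1 <= K)%N.
  have h : 1 <= 2 * b%:~R * t + a' by lra.
  by rewrite -(ler_nat R) KR; nra.
pose r := [seq M + k%:Z | k <- index_iota 1 N.+1].
have ur : uniq r by rewrite map_inj_uniq ?iota_uniq // => i j /addrI [].
have rM n : n \in r -> M < n <= M + N%:Z.
  move=> /mapP[k]; rewrite mem_index_iota ltnS => /andP[k0' kN] ->.
  by rewrite ltrDl lerD2l ltz_nat lez_nat k0' kN.
pose D : R := C0 * K.*2%:R `^ eps.
have D0 : 0 <= D by rewrite mulr_ge0 ?powR_ge0 // ltW.
rewrite fsbig_finite; last exact: finite_farey.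
rewrite /ZFactor -(big_map (fun k : nat => M + k%:Z) predT
  (fun n => Normc.normc (u n) ^+ 2)) -/r.
under eq_bigr do rewrite -(big_map (fun k : nat => M + k%:Z) predT
  (fun n => u n * e2pi (ratr _ * quadf alpha beta gamma n%:~R))) -/r.
apply: le_trans (farey_quadratic_sieve
  (Y := fun n => quadf alpha beta gamma n%:~R)
  (kappa := kappa) (K := K) (D := D) (a := a) (b := b)
  u Q0 k0 b0 _ _ ur _ _ D0 _) _.
- exact: finmap.fset_uniq.
- by move=> x; rewrite in_fset_set ?inE //; exact: finite_farey.
- by move=> n m; exact: quadf_difference.
- by move=> n m /rM nM /rM mM; exact: (quadratic_frequency_bound b0 eK nM mM).
- move=> k /andP[kpos kK]; apply: le_trans (divC _ kpos) _.
  rewrite ler_wpM2l ?(ltW C0_gt0) // ge0_ler_powR ?nnegrE ?(ltW eps_gt0) //.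
  by rewrite ler_nat.
apply: ler_wpM2r; first by apply: sumr_ge0 => n _; exact: sqr_ge0.
rewrite /PiFactor -/t -/a'.
set G := b%:~R / alpha + 1; set B := _ + _ + b%:~R / alpha.
have ba0 : 0 < b%:~R / alpha by rewrite divr_gt0.
have G1 : 1 <= G by rewrite lerDr ltW.
have B1 : N%:R * (b%:~R * t) + a' <= B by rewrite /B -mulrA lerDl ltW.
have B1' : 1 <= B by apply: le_trans B1; nra.
(* [N |a|] is at most the square of the bracket [B], hence so is [K] up to a
   constant; the square root of the divisor bound then restores the
   exponent [eps]. *)
have KB : K.*2%:R <= 6 * B ^+ 2.
  have -> : K.*2%:R = 2 * K%:R :> R by rewrite -natrM mul2n.
  rewrite KR.
  have h1 : N%:R * (b%:~R * t) <= B by lra.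
  have h2 : N%:R <= B by nra.
  have h3 : a' <= B by nra.
  nra.
set P := G `^ _ * _.
have P1 : 1 <= P.
  have one_le_powR (x p : R) : 1 <= x -> 0 <= p -> 1 <= x `^ p.
    move=> x1 p0; have <- : 1 `^ p = 1 :> R by rewrite powR1.
    by apply: ge0_ler_powR; rewrite ?nnegrE //; lra.
  rewrite -[1]mulr1 ler_pM //; apply: one_le_powR => //; lra.
have P2 : G * (B ^+ 2) `^ eps <= P ^+ 2.
  rewrite exprMn powRXn; last by lra.
  apply: ler_wpM2r; first exact: sqr_ge0.
  rewrite -powRXn; last by lra.
  rewrite -powR_mulrn; last by lra.
  rewrite -powRrM -[leLHS]powRr1; last by lra.
  by apply: ler_powR => //; lra.
have E0 : Q%:R ^+ 2 <= E.
  by rewrite /E lerDl mulr_ge0 ?sqrtr_ge0.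
have E2 : Q%:R ^+ 2 * (Q%:R ^+ 2 + Y) <= E ^+ 2.
  rewrite /E; set h := Num.sqrt _.
  have hh : h ^+ 2 = Y + 1 by rewrite sqr_sqrtr // addr_ge0.
  have h0 : 0 <= h by exact: sqrtr_ge0.
  have -> : (Q%:R ^+ 2 + Q%:R * h) ^+ 2
    = Q%:R ^+ 2 * (Q%:R ^+ 2 + h ^+ 2 + 2 * (Q%:R * h)) by ring.
  rewrite hh; apply: ler_wpM2l; first exact: sqr_ge0.
  have Qh0 : 0 <= Q%:R * h := mulr_ge0 (ler0n _ _) h0.
  lra.
have Q20 : 0 <= Q%:R ^+ 2 :> R by exact: sqr_ge0.
have E0' : 0 <= E := le_trans Q20 E0.
have -> : (2 + Num.sqrt C1) * E * P = 2 * (E * P) + Num.sqrt C1 * E * P by ring.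
apply: lerD.
  apply: ler_wpM2l => //; apply: le_trans E0 _; exact: ler_peMr.
have CEP0 : 0 <= Num.sqrt C1 * E * P.
  exact: mulr_ge0 (mulr_ge0 (sqrtr_ge0 _) E0') (le_trans ler01 P1).
rewrite -[leRHS]ger0_norm // -sqrtr_sqr; apply: ler_wsqrtr.
rewrite 2!exprMn sqr_sqrtr //.
have D1 : D <= C0 * (6 `^ eps * (B ^+ 2) `^ eps).
  apply: ler_wpM2l; first exact: ltW.
  rewrite -powRM ?sqr_ge0 //.
  apply: (ge0_ler_powR (ltW eps_gt0) _ _ KB); rewrite nnegrE //.
  by rewrite mulr_ge0 ?sqr_ge0.
have kK : (2 * kappa + 3) * (K.*2.+1%:R + Q%:R ^+ 2 / kappa)
    <= 18 * G * (Q%:R ^+ 2 + Y).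
  have kKY : kappa * K%:R <= 2 * Y.
    have -> : kappa * K%:R = alpha * N%:R * (2 * t + a' / b%:~R).
      by rewrite KR /kappa; field; rewrite gt_eqF.
    have -> : 2 * Y = alpha * N%:R * (2 * t + 2 * (a' / b%:~R)).
      by rewrite /Y; ring.
    rewrite ler_wpM2l ?mulr_ge0 ?(ltW al0) // lerD2l.
    have ab0 : 0 <= a' / b%:~R := divr_ge0 a'0 (ltW b_gt0).
    by rewrite ler_peMl // ler1n.
  have -> : G = (kappa + 1) / kappa.
    by rewrite /G /kappa; field; rewrite !gt_eqF.
  have -> : 18 * ((kappa + 1) / kappa) * (Q%:R ^+ 2 + Y)
      = (3 * (kappa + 1)) * (6 * (Q%:R ^+ 2 + Y) / kappa).
    by field; rewrite gt_eqF.
  have K3 : K.*2.+1%:R <= 3 * K%:R :> R.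
    by rewrite -natrM ler_nat; clear -K1; lia.
  have kK3 : K.*2.+1%:R * kappa <= 3 * (kappa * K%:R).
    by rewrite [leRHS]mulrCA [leRHS]mulrC ler_wpM2r ?(ltW k0).
  have Qk0 : 0 <= Q%:R ^+ 2 / kappa := divr_ge0 Q20 (ltW k0).
  apply: ler_pM.
  - by clear -k0; lra.
  - by rewrite addr_ge0.
  - clear -k0; lra.
  rewrite ler_pdivlMr // mulrDl divfK ?gt_eqF //.
  clear -kK3 kKY Y0 Q20; lra.
have DG : D * G <= C0 * 6 `^ eps * P ^+ 2.
  apply: le_trans (ler_wpM2r _ D1) _; first by lra.
  rewrite -!mulrA ler_wpM2l ?(ltW C0_gt0) // ler_wpM2l ?powR_ge0 //.
  by rewrite mulrC.
have -> : C1 * E ^+ 2 * P ^+ 2 = 576 * (E ^+ 2 * (C0 * 6 `^ eps * P ^+ 2)).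
  by rewrite /C1; ring.
apply: (@le_trans _ _ (32 * D * Q%:R ^+ 2 * (18 * G * (Q%:R ^+ 2 + Y)))).
  rewrite -[leLHS]mulrA; apply: ler_wpM2l kK.
  exact: mulr_ge0 (mulr_ge0 (ler0n _ _) D0) Q20.
have -> : 32 * D * Q%:R ^+ 2 * (18 * G * (Q%:R ^+ 2 + Y))
    = 576 * (Q%:R ^+ 2 * (Q%:R ^+ 2 + Y) * (D * G)) by ring.
apply: (ler_wpM2l (ler0n _ 576)); apply: ler_pM => //.
  exact: mulr_ge0 Q20 (addr_ge0 Q20 Y0).
exact: mulr_ge0 D0 (le_trans ler01 G1).
Qed.
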